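(* Let $\mathfrak{U}$ be any family of finite-dimensional unitary groups equipped with bi-invariant submultiplicative norms, let $\Gamma$ be a countable group and let $N\le\Gamma$ be an amenable normal subgroup. If $\Gamma$ is uniformly $\mathfrak{U}$-stable with a linear estimate, then so is $\Gamma/N$.
   Context: **Stability.** All groups are discrete and countable; $\omega$ is a fixed non-principal ultrafilter on $\mathbb{N}=\{0,1,2,\dots\}$. $\mathfrak{U}$ is a family of pairs $(U(k),\|\cdot\|)$, where $U(k)$ is the group of $k\times k$ unitary matrices and $\|\cdot\|$ is a norm on $k\times k$ complex matrices that is submultiplicative ($\|AB\|\le\|A\|\|B\|$) and bi-invariant ($\|uAv\|=\|A\|$ for $u,v\in U(k)$); the same $U(k)$ may occur several times with different norms. For a group $G$ and maps $\phi,\psi:G\to U(k)$ put $\operatorname{def}(\phi)=\sup_{g,h\in G}\|\phi(gh)-\phi(g)\phi(h)\|$ and $\operatorname{dist}(\phi,\psi)=\sup_{g\in G}\|\phi(g)-\psi(g)\|$. A *uniform asymptotic homomorphism* $\phi:G\to\mathfrak{U}$ is a sequence of maps $\phi_n:G\to U(k_n)$, with $(U(k_n),\|\cdot\|)\in\mathfrak{U}$, such that $\operatorname{def}(\phi_n)\to 0$. $G$ is *uniformly $\mathfrak{U}$-stable* if for every uniform asymptotic homomorphism $(\phi_n)$ there are homomorphisms $\psi_n:G\to U(k_n)$ with $\operatorname{dist}(\phi_n,\psi_n)\to 0$. It is *uniformly $\mathfrak{U}$-stable with a linear estimate* if for every uniform asymptotic homomorphism $(\phi_n)$ there are homomorphisms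 $\psi_n:G\to U(k_n)$ with $\operatorname{dist}(\phi_n,\psi_n)=O_\omega(\operatorname{def}(\phi_n))$, i.e. there are $C\ge 0$ and $S\in\omega$ such that $\operatorname{dist}(\phi_n,\psi_n)\le C\operatorname{def}(\phi_n)$ for all $n\in S$. *)

(* Defs.v *)
From HB Require Import structures.
From mathcomp Require Import all_boot all_order all_algebra all_fingroup.
From mathcomp Require Import sesquilinear spectral generic_quotient.
From mathcomp Require Import complex.
From mathcomp Require Import all_classical all_reals all_analysis.

Set Implicit Arguments.
Unset Strict Implicit.
Unset Printing Implicit Defensive.
Import Order.TTheory GRing.Theory Num.Theory.
Import numFieldNormedType.Exports.
Local Open Scope classical_set_scope.
Local Open Scope ring_scope.
Local Open Scope complex_scope.
Local Open Scope sesquilinear_scope.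

HB.mixin Record isConjClosed (G : groupType) (S : {pred G}) := {
  gpredJr : forall x y : G, x \in S -> (x ^ y)%g \in S
}.

#[short(type="normalClosed")]
HB.structure Definition NormalClosed (G : groupType) :=
  {S of isConjClosed G S & GroupClosed G S}.

Definition subgroup_type (G : groupType) (S : groupClosed G) : Type :=
  {x : G | x \in (S : {pred G})}.

Section SubgroupType.
Variables (G : groupType) (S : groupClosed G).

HB.instance Definition _ := SubChoice.on (subgroup_type S).

Fact subgroup_type_closed : group_closed (fun x : G => x \in (S : {pred G})).
Proof. by split; [exact: gpred1|move=> x y; exact: gpredF]. Qed.

HB.instance Definition _ :=
  SubChoice_isSubGroup.Build G _ (subgroup_type S) subgroup_type_closed.

End SubgroupType.

Section Quotient.
Variables (G : groupType) (N : normalClosed G).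
Local Open Scope quotient_scope.

(* x N = y N *)
Definition coset_rel (x y : G) : bool := (x^-1 * y)%g \in (N : {pred G}).

Fact coset_rel_refl : reflexive coset_rel.
Proof. by move=> x; rewrite /coset_rel mulVg gpred1. Qed.

Fact coset_rel_sym : symmetric coset_rel.
Proof. by move=> x y; rewrite /coset_rel -gpredV invgM invgK. Qed.

Fact coset_rel_trans : transitive coset_rel.
Proof.
move=> y x z xy yz; rewrite /coset_rel.
by rewrite -[z](mulVKg y) mulgA gpredM.
Qed.

Canonical coset_equiv :=
  EquivRel coset_rel coset_rel_refl coset_rel_sym coset_rel_trans.

Definition quotient_group : Type := {eq_quot coset_rel}.

HB.instance Definition _ := Choice.on quotient_group.
HB.instance Definition _ := EqQuotient.on quotient_group.

Definition quotient_proj (x : G) : quotient_group := \pi_quotient_group x.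

Lemma eq_quotient_projP (x y : G) :
  quotient_proj x = quotient_proj y <-> (x^-1 * y)%g \in (N : {pred G}).
Proof. by split=> [/eqmodP|H]; last exact/eqmodP. Qed.

Lemma quotient_projK (a : quotient_group) : quotient_proj (repr a) = a.
Proof. exact: reprK. Qed.

Definition quotient_one : quotient_group := quotient_proj 1%g.
Definition quotient_inv (a : quotient_group) : quotient_group :=
  quotient_proj (repr a)^-1%g.
Definition quotient_mul (a b : quotient_group) : quotient_group :=
  quotient_proj (repr a * repr b)%g.

Lemma quotient_projM x y :
  quotient_proj (x * y)%g = quotient_mul (quotient_proj x) (quotient_proj y).
Proof.
apply/eq_quotient_projP; set x' := repr _; set y' := repr _.
have hx : (x^-1 * x')%g \in (N : {pred G}).
  by apply/eq_quotient_projP; rewrite quotient_projK.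
have hy : (y^-1 * y')%g \in (N : {pred G}).
  by apply/eq_quotient_projP; rewrite quotient_projK.
suff -> : ((x * y)^-1 * (x' * y') = (x^-1 * x') ^ y * (y^-1 * y'))%g.
  by rewrite gpredM // gpredJr.
by rewrite /conjg invgM !mulgA mulgK.
Qed.

Lemma quotient_projV x :
  quotient_proj x^-1%g = quotient_inv (quotient_proj x).
Proof.
apply/eq_quotient_projP; set x' := repr _.
have hx : (x'^-1 * x)%g \in (N : {pred G}).
  by apply/eq_quotient_projP; rewrite quotient_projK.
suff -> : (x^-1^-1 * x'^-1 = (x'^-1 * x) ^ x^-1)%g by rewrite gpredJr.
by rewrite /conjg invgK mulgK.
Qed.

Fact quotient_mulA : associative quotient_mul.
Proof.
move=> a b c; rewrite -(quotient_projK a) -(quotient_projK b).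
by rewrite -(quotient_projK c) -!quotient_projM mulgA.
Qed.

Fact quotient_mul1g : left_id quotient_one quotient_mul.
Proof. by move=> a; rewrite -(quotient_projK a) -quotient_projM mul1g. Qed.

Fact quotient_mulg1 : right_id quotient_one quotient_mul.
Proof. by move=> a; rewrite -(quotient_projK a) -quotient_projM mulg1. Qed.

Fact quotient_mulVg : left_inverse quotient_one quotient_inv quotient_mul.
Proof.
move=> a; rewrite -(quotient_projK a) -quotient_projV -quotient_projM.
by rewrite mulVg.
Qed.

Fact quotient_mulgV : right_inverse quotient_one quotient_inv quotient_mul.
Proof.
move=> a; rewrite -(quotient_projK a) -quotient_projV -quotient_projM.
by rewrite mulgV.
Qed.

HB.instance Definition _ := isGroup.Build quotient_group
  quotient_mulA quotient_mul1g quotient_mulg1 quotient_mulVg quotient_mulgV.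

Fact quotient_proj_morph : {morph quotient_proj : x y / (x * y)%g}.
Proof. exact: quotient_projM. Qed.

HB.instance Definition _ :=
  isMultiplicative.Build G quotient_group quotient_proj quotient_proj_morph.

End Quotient.

(* A left-invariant mean on the real space l^oo(G); the values of [m] on
   unbounded functions are irrelevant. *)
Definition invariant_mean (R : realType) (G : groupType)
    (m : (G -> R) -> R) : Prop :=
  [/\ m (fun=> 1) = 1,
      forall f : G -> R, bounded_fun f -> (forall x, 0 <= f x) -> 0 <= m f,
      forall a (f g : G -> R), bounded_fun f -> bounded_fun g ->
        m (fun x => a * f x + g x) = a * m f + m g
    & forall h (f : G -> R), bounded_fun f -> m (fun x => f (h * x)%g) = m f].

Definition amenable (R : realType) (G : groupType) : Prop :=
  exists m : (G -> R) -> R, invariant_mean m.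

Definition unitary_group (R : realType) (k : nat) : Type :=
  {A : 'M[R[i]]_k | A \is unitarymx}.

Definition umx (R : realType) (k : nat) (A : unitary_group R k) : 'M[R[i]]_k :=
  sval A.

Section UnitaryGroup.
Variables (R : realType) (k : nat).
Local Notation U := (unitary_group R k).

HB.instance Definition _ := SubChoice.on U.

Fact unitary_oneP : (1%:M : 'M[R[i]]_k) \is unitarymx.
Proof. by apply/unitarymxP; rewrite trmx1 map_mx1 mulmx1. Qed.

Fact unitary_invP (A : U) : (invmx (umx A)) \is unitarymx.
Proof.
have hA : umx A \is unitarymx := valP A; apply/unitarymxP; rewrite invmx_unitary //.
by rewrite trmxCK -invmx_unitary // mulVmx // unitarymx_unit.
Qed.

Definition unitary_one : U := Sub 1%:M unitary_oneP.
Definition unitary_inv (A : U) : U := Sub (invmx (umx A)) (unitary_invP A).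
Definition unitary_mul (A B : U) : U :=
  Sub (umx A *m umx B) (mul_unitarymx (valP A) (valP B)).

Fact unitary_mulA : associative unitary_mul.
Proof. by move=> A B C; apply/val_inj; rewrite /= mulmxA. Qed.

Fact unitary_mul1g : left_id unitary_one unitary_mul.
Proof. by move=> A; apply/val_inj; rewrite /= mul1mx. Qed.

Fact unitary_mulg1 : right_id unitary_one unitary_mul.
Proof. by move=> A; apply/val_inj; rewrite /= mulmx1. Qed.

Fact unitary_mulVg : left_inverse unitary_one unitary_inv unitary_mul.
Proof.
by move=> A; apply/val_inj; rewrite /= mulVmx // unitarymx_unit // (valP A).
Qed.

Fact unitary_mulgV : right_inverse unitary_one unitary_inv unitary_mul.
Proof.
by move=> A; apply/val_inj; rewrite /= mulmxV // unitarymx_unit // (valP A).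
Qed.

HB.instance Definition _ := isGroup.Build U
  unitary_mulA unitary_mul1g unitary_mulg1 unitary_mulVg unitary_mulgV.

End UnitaryGroup.

Record normed_unitary (R : realType) := NormedUnitary {
  udim : nat;
  unorm : 'M[R[i]]_udim -> R;
  unormD : forall A B, unorm (A + B) <= unorm A + unorm B;
  unormZ : forall (a : R[i]) A, unorm (a *: A) = Normc.normc a * unorm A;
  unorm_eq0 : forall A, unorm A = 0 -> A = 0;
  unormM : forall A B, unorm (A *m B) <= unorm A * unorm B;
  unorm_biinv : forall (u v : unitary_group R udim) A,
    unorm (umx u *m A *m umx v) = unorm A
}.

Definition udistance (R : realType) (u : normed_unitary R)
    (A B : unitary_group R (udim u)) : R :=
  unorm (umx A - umx B).

Section Stability.
Variables (R : realType) (G : groupType).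

(* The sets in the two suprema are nonempty and bounded above, so that the real
   [sup] is their least upper bound: see [has_sup_defect], [has_sup_dist]. *)
Definition hom_defect (u : normed_unitary R) (phi : G -> unitary_group R (udim u)) : R :=
  sup [set udistance (phi (g.1 * g.2)%g) (phi g.1 * phi g.2)%g
      | g in [set: G * G]].

Definition map_dist (u : normed_unitary R) (phi psi : G -> unitary_group R (udim u)) : R :=
  sup [set udistance (phi g) (psi g) | g in [set: G]].

Lemma udistance_bound (u : normed_unitary R) (A B : unitary_group R (udim u)) :
  udistance A B <= unorm (1%:M : 'M[R[i]]_(udim u)) *+ 2.
Proof.
have normU (C : unitary_group R (udim u)) :
    unorm (umx C) = unorm (1%:M : 'M[R[i]]_(udim u)).
  rewrite -(unorm_biinv C (unitary_one R _) 1%:M).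
  by rewrite /= !mulmx1.
rewrite /udistance (le_trans (unormD _ _)) // -scaleN1r unormZ !normU mulr2n.
by rewrite normcN Normc.normc1 mul1r.
Qed.

Lemma has_sup_defect (u : normed_unitary R) (phi : G -> unitary_group R (udim u)) :
  has_sup [set udistance (phi (g.1 * g.2)%g) (phi g.1 * phi g.2)%g
          | g in [set: G * G]].
Proof.
split; first by eexists; exists (1%g, 1%g).
exists (unorm (1%:M : 'M[R[i]]_(udim u)) *+ 2) => _ [g _ <-].
exact: udistance_bound.
Qed.

Lemma has_sup_dist (u : normed_unitary R) (phi psi : G -> unitary_group R (udim u)) :
  has_sup [set udistance (phi g) (psi g) | g in [set: G]].
Proof.
split; first by eexists; exists 1%g.
exists (unorm (1%:M : 'M[R[i]]_(udim u)) *+ 2) => _ [g _ <-].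
exact: udistance_bound.
Qed.

Definition uniform_asymptotic_hom (UU : set (normed_unitary R))
    (u : nat -> normed_unitary R) (phi : forall n, G -> unitary_group R (udim (u n))) : Prop :=
  (forall n, UU (u n)) /\ hom_defect (phi n) @[n --> \oo] --> (0 : R).

Definition uniformly_stable_linear (omega : set_system nat)
    (UU : set (normed_unitary R)) : Prop :=
  forall (u : nat -> normed_unitary R) (phi : forall n, G -> unitary_group R (udim (u n))),
    uniform_asymptotic_hom UU phi ->
    exists psi : forall n, {multiplicative G -> unitary_group R (udim (u n))},
    exists2 C : R, 0 <= C &
    exists2 S : set nat, omega S &
      forall n, S n -> map_dist (phi n) (psi n) <= C * hom_defect (phi n).

End Stability.

Definition nonprincipal (T : Type) (F : set_system T) : Prop :=
  forall x : T, F <> principal_filter x.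

(* Main.v *)
(** Pull an asymptotic homomorphism [phi] of [Gamma/N] back to [Gamma] and let
    [psi] be the homomorphisms provided by stability.  On [N] the pullback is
    constant and close to [1], so [psi n] maps [N] to a subgroup all of whose
    elements [V] satisfy [unorm (V - 1) <= d] with [d < 1], for large [n].
    Such a subgroup is trivial: from [2 (V - 1) = (V ^ 2 - 1) - (V - 1) ^ 2],
    the supremum [s] of [unorm (V - 1)] satisfies [2 s <= s + s ^ 2], so [s = 0].
    Hence [psi n] factors through [Gamma/N] exactly. *)
Require Import Defs.
From HB Require Import structures.
From mathcomp Require Import all_boot all_order all_algebra.
From mathcomp Require Import all_classical all_reals all_analysis.
From mathcomp Require Import complex lra.

Import Order.TTheory GRing.Theory Num.Theory.
Import numFieldNormedType.Exports.
Local Open Scope classical_set_scope.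
Local Open Scope ring_scope.

(** Otherwise the ultrafilter contains [[set x]]; then every member of [F] meets [[set x]], hence
    contains [x], and [F] is the principal filter at [x]. *)
Lemma nonprincipal_ultra_cofinite {T : Type} {F : set_system T} (x : T) :
  UltraFilter F -> nonprincipal F -> F (~` [set x]).
Proof.
move=> FU Fnp; have [Fx|//] := in_ultra_setVsetC [set x] FU.
case: (Fnp x); apply/seteqP; split=> A FA.
  move=> y /= ->; have [z []] := filter_ex (filterI Fx FA).
  by move=> /= ->.
by apply: filterS Fx => y; exact: FA.
Qed.

(** Turns convergence along [\oo] into membership in the ultrafilter. By induction, the tail from
    [M.+1] is the tail from [M] with the point [M] removed. *)
Lemma nonprincipal_ultra_eventually {F : set_system nat} :
  UltraFilter F -> nonprincipal F -> \oo `<=` F.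
Proof.
move=> FU Fnp A [M _ MA]; apply: filterS MA _.
elim: M => [|M IHM]; first by apply: filterS filterT => n.
apply: filterS (filterI IHM (nonprincipal_ultra_cofinite M FU Fnp)) => n /= [].
by rewrite [(M < n)%N]ltn_neqAle => -> nM; rewrite andbT eq_sym; apply/eqP.
Qed.

Section UnitaryNorm.
Context {R : realType} {u : normed_unitary R}.
Local Notation U := (unitary_group R (udim u)).
Implicit Types (A B : 'M[R[i]%C]_(udim u)) (V W : U).

Lemma unorm0 : unorm (0 : 'M[R[i]%C]_(udim u)) = 0.
Proof. by rewrite -(scale0r 0) unormZ Normc.normc0 mul0r. Qed.

Lemma unormN A : unorm (- A) = unorm A.
Proof. by rewrite -scaleN1r unormZ normcN Normc.normc1 mul1r. Qed.

Lemma unorm_ge0 A : 0 <= unorm A.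
Proof. by have := unormD A (- A); rewrite subrr unorm0 unormN; lra. Qed.

Lemma unormMn A n : unorm (A *+ n) = unorm A *+ n.
Proof.
by rewrite -scaler_nat unormZ normcMn Normc.normc1 mulr_natl.
Qed.

Lemma unormMl V A : unorm (umx V *m A) = unorm A.
Proof. by rewrite -(unorm_biinv V 1%g A) [umx 1%g]/= mulmx1. Qed.

Lemma udistanceC V W : udistance V W = udistance W V.
Proof. by rewrite /udistance -unormN opprB. Qed.

Lemma udistance_ge0 V W : 0 <= udistance V W.
Proof. exact: unorm_ge0. Qed.

Lemma udistance_triangle V1 V2 V3 :
  udistance V1 V3 <= udistance V1 V2 + udistance V2 V3.
Proof.
rewrite /udistance (_ : umx V1 - umx V3 = umx V1 - umx V2 + (umx V2 - umx V3)).
  exact: unormD.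
by rewrite addrA subrK.
Qed.

Lemma udistance_eq0 V W : udistance V W = 0 -> V = W.
Proof. by move/unorm_eq0/subr0_eq => ?; exact/val_inj. Qed.

Lemma udistanceMl (V1 V2 W : U) : udistance (W * V1)%g (W * V2)%g = udistance V1 V2.
Proof. by rewrite /udistance -mulmxBr unormMl. Qed.

(** With [A] standing for [V - 1], this is the triangle inequality for
    [A *+ 2 = (V ^ 2 - 1) - A ^ 2], where submultiplicativity bounds the last term. *)
Lemma udistance_sqr V :
  udistance V 1%g *+ 2 <= udistance (V * V)%g 1%g + udistance V 1%g ^+ 2.
Proof.
rewrite /udistance -unormMn.
set A := umx V - _.
have -> : A *+ 2 = umx (V * V)%g - umx (1%g : U) - A *m A.
  rewrite /A [umx (V * V)%g]/= [umx 1%g]/= mulmxBl !mulmxBr !mulmx1 !mul1mx.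
  by rewrite opprB [RHS]addrC -addrA mulr2n opprB subrKA.
by rewrite (le_trans (unormD _ _)) // unormN lerD2l unormM.
Qed.

Lemma no_small_subgroup (S : set U) (d : R) : d < 1 ->
    (forall V, S V -> S (V * V)%g) ->
    (forall V, S V -> udistance V 1%g <= d) ->
  forall V, S V -> V = 1%g.
Proof.
move=> d1 Ssqr Sd V SV; pose E := [set udistance W 1%g | W in S].
have E0 : E !=set0 by exists (udistance V 1%g), V.
have Eub : has_ubound E by exists d => _ [W SW <-]; exact: Sd.
have sE W : S W -> udistance W 1%g <= sup E.
  by move=> SW; apply: ub_le_sup => //; exists W.
have sd : sup E <= d by apply: ge_sup => // _ [W SW <-]; exact: Sd.
have s0 : 0 <= sup E by rewrite (le_trans (udistance_ge0 V 1%g)) // sE.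
(* Both [W] and [W * W] lie in [S], so both are within [sup E] of 1. *)
have : sup E <= (sup E + sup E ^+ 2) / 2.
  apply: ge_sup => // _ [W SW <-].
  have sW := sE _ SW; have sWW := sE _ (Ssqr _ SW).
  have := udistance_sqr W; have := udistance_ge0 W 1%g; nra.
move=> s2; apply/udistance_eq0/eqP; rewrite eq_le udistance_ge0 andbT.
(* Here [s = sup E] satisfies [s <= s ^ 2] and [0 <= s <= d < 1], which forces [s <= 0]. *)
by apply: le_trans (sE _ SV) _; nra.
Qed.

Section Suprema.
Context {G : groupType}.
Implicit Types phi psi : G -> U.

Lemma le_hom_defect phi (g h : G) :
  udistance (phi (g * h)%g) (phi g * phi h)%g <= hom_defect phi.
Proof. by apply: sup_upper_bound; [exact: has_sup_defect|exists (g, h)]. Qed.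

Lemma le_map_dist phi psi (g : G) : udistance (phi g) (psi g) <= map_dist phi psi.
Proof. by apply: sup_upper_bound; [exact: has_sup_dist|exists g]. Qed.

(** [phi] need not be unital. The defect at [(1, 1)] compares [phi 1 * 1] with [phi 1 * phi 1], and
    invariance of the norm cancels the left factor. *)
Lemma udistance1_hom_defect phi : udistance 1%g (phi 1%g) <= hom_defect phi.
Proof.
by have := le_hom_defect phi 1%g 1%g; rewrite mulg1 -{1}[phi 1%g]mulg1 udistanceMl.
Qed.

End Suprema.
End UnitaryNorm.

Section QuotientMaps.
Context {G : groupType} {N : normalClosed G}.
Local Notation proj := (@quotient_proj G N).

Lemma quotient_hom_factor {H : groupType} (f : {multiplicative G -> H}) :
    (forall x, x \in (N : {pred G}) -> f x = 1%g) ->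
  exists f' : {multiplicative quotient_group N -> H}, forall x, f' (proj x) = f x.
Proof.
move=> fN; pose f' (a : quotient_group N) := f (repr a).
have f'E x : f' (proj x) = f x.
  (* Write [x = r * (r^-1 * x)] with [r = repr (proj x)]; the second factor lies in [N], where [f]
     is trivial. *)
  rewrite -[x in RHS](mulVKg (repr (proj x))) gmulfM (fN (_ * x)%g) ?mulg1 //.
  by apply/eq_quotient_projP; rewrite quotient_projK.
have f'M : {morph f' : a b / (a * b)%g}.
  move=> a b; rewrite -(quotient_projK a) -(quotient_projK b).
  by rewrite -gmulfM !f'E gmulfM.
pose F : {multiplicative quotient_group N -> H} :=
  HB.pack f' (isMultiplicative.Build _ _ f' f'M).
by exists F.
Qed.

Context {R : realType} {u : normed_unitary R}.
Local Notation U := (unitary_group R (udim u)).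

(** Since [proj] is onto, with section [repr], both suprema are taken over the same set of reals. *)
Lemma hom_defect_quotient (phi : quotient_group N -> U) :
  hom_defect (phi \o proj) = hom_defect phi.
Proof.
congr sup; apply/seteqP; split=> _ [[a b] _ <-] /=.
  by exists (proj a, proj b); rewrite //= quotient_projM.
by exists (repr a, repr b); rewrite //= quotient_projM !quotient_projK.
Qed.

Lemma map_dist_quotient (phi psi : quotient_group N -> U) :
  map_dist (phi \o proj) (psi \o proj) = map_dist phi psi.
Proof.
congr sup; apply/seteqP; split=> _ [a _ <-] /=; first by exists (proj a).
by exists (repr a); rewrite //= !quotient_projK.
Qed.

Lemma hom_near_quotient_map_trivial (phi : quotient_group N -> U)
    (psi : {multiplicative G -> U}) :
    map_dist (phi \o proj) psi + hom_defect phi < 1 ->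
  forall x, x \in (N : {pred G}) -> psi x = 1%g.
Proof.
move=> d1 x xN.
apply: (no_small_subgroup (psi @` [set y | y \in (N : {pred G})]) _ d1); last by exists x.
  by move=> _ [y yN <-]; exists (y * y)%g; rewrite ?gmulfM //= gpredM.
(* Compare [psi y] with 1 through [phi 1]: as [proj y = 1], the first leg is at most [map_dist], and
   the second is at most [hom_defect]. *)
move=> _ [y yN <-]; rewrite (le_trans (udistance_triangle _ (phi 1%g) _)) //.
rewrite lerD // udistanceC; last exact: udistance1_hom_defect.
suff <- : proj y = 1%g by exact: (le_map_dist (phi \o proj) psi).
by apply/(@eq_quotient_projP _ _ y 1%g); rewrite mulg1 gpredV.
Qed.

End QuotientMaps.

Theorem proposition1p6 (R : realType)
    (omega : set_system nat) (omega_ultra : UltraFilter omega)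
    (omega_nonprincipal : nonprincipal omega)
    (UU : set (normed_unitary R))
    (Gamma : groupType) (Gamma_countable : countable [set: Gamma])
    (N : normalClosed Gamma) (N_amenable : amenable R (subgroup_type N)) :
  uniformly_stable_linear Gamma omega UU ->
  uniformly_stable_linear (quotient_group N) omega UU.
Proof.
move=> stable u phi [uUU phi0].
pose phi' n := phi n \o @quotient_proj _ N.
have defE n : hom_defect (phi' n) = hom_defect (phi n) by exact: hom_defect_quotient.
have [|psi [C C0 [S omegaS psiS]]] := stable u phi'.
  by split=> //; under eq_fun do rewrite defE.
pose trivial_on_N n := forall x, x \in (N : {pred Gamma}) -> psi n x = 1%g.
have psi'P n :
    exists f : {multiplicative quotient_group N -> unitary_group R (udim (u n))},
      trivial_on_N n -> forall x, f (quotient_proj N x) = psi n x.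
  have [/quotient_hom_factor[f fE]|nt] := pselect (trivial_on_N n); first by exists f.
  (* The trivial homomorphism is only a default value, for indices that the set chosen below
     excludes. *)
  by exists (monoid.one_fun _).
pose psi' n := projT1 (cid (psi'P n)).
have psi'E n : trivial_on_N n -> forall x, psi' n (quotient_proj N x) = psi n x.
  by rewrite /psi'; case: cid.
(* In the factor [C + 1], [C] accounts for the distance from the pullback to [psi n], and 1 for the
   distance from [phi n 1] to 1. *)
exists psi', C => //; exists (S `&` [set n | (C + 1) * hom_defect (phi n) < 1]).
  apply: filterI => //; apply: (nonprincipal_ultra_eventually omega_ultra) => //.
  have /cvgr_lt : (C + 1) * hom_defect (phi n) @[n --> \oo] --> (0 : R).
    by rewrite -(mulr0 (C + 1)); exact: cvgM (cvg_cst _) phi0.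
  by apply; exact: ltr01.
move=> n [/psiS]; rewrite defE => dist_n /= small_n.
have trN : trivial_on_N n.
  apply: (hom_near_quotient_map_trivial (phi n)); apply: le_lt_trans small_n.
  by rewrite mulrDl mul1r lerD2r.
(* Passing to the quotient preserves both the distance and the defect, so the constant [C] is
   unchanged. *)
rewrite -map_dist_quotient (_ : psi' n \o _ = psi n) //.
by apply/funext => x; exact: psi'E.
Qed.
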